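(* Let $R$ be a commutative ring with unit and let $F=\prod_{i\in\mathcal{A}}R$ for an index set $\mathcal{A}$. Let $\underline{s}=s_1,\dots,s_k$ be a permutable weak regular sequence in $R$, none of whose members is a unit. Let $U=\langle a_1,\dots,a_n\rangle\subseteq F$ be the $R$-submodule generated by $\underline{s}$-monomial type terms $a_1,\dots,a_n$. Then $U$ admits a free $R$-resolution $$0\rightarrow F_p\rightarrow F_{p-1}\rightarrow\dots\rightarrow F_1\rightarrow F_0\rightarrow U\rightarrow 0$$ of length $p\le k$.
   Context: A sequence $s_1,\dots,s_k$ in $R$ is a weak regular sequence if, for each $i$, $s_i$ is a nonzerodivisor on $R/\langle s_1,\dots,s_{i-1}\rangle$; it is permutable if every permutation of it is again a weak regular sequence. An $\underline{s}$-monomial is an element $s_1^{\alpha_1}\cdots s_k^{\alpha_k}$ with $\alpha_i\in\mathbb{Z}_{\ge0}$ (so $1$ is an $\underline{s}$-monomial); an $\underline{s}$-term is a unit of $R$ times an $\underline{s}$-monomial. For $i\in\mathcal{A}$ let $e_i\in F$ be the element with $i$-th coordinate $1$ and all other coordinates $0$. An $\underline{s}$-monomial type term of $F$ is an element $ae_i$ with $i\in\mathcal{A}$ and $a$ an $\underline{s}$-term. *)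

(* Defs.v *)
From HB Require Import structures.
From mathcomp Require Import all_boot all_order all_algebra perm.
From mathcomp Require Import boolp classical_sets functions.

Set Implicit Arguments.
Unset Strict Implicit.
Unset Printing Implicit Defensive.

Import GRing.Theory.
Local Open Scope classical_set_scope.
Local Open Scope ring_scope.

(* Rings are [comPzRingType]s, so the zero ring is allowed. *)

Definition submod_gen (R : pzRingType) (M : lmodType R) (J : finType)
    (P : pred J) (a : J -> M) : set M :=
  [set x | exists c : J -> R, x = \sum_(j | P j) c j *: a j].

(* [GRing.unit] is only available on rings with 1 != 0 *)
Definition is_unit (R : comPzRingType) (u : R) : Prop :=
  exists v : R, u * v = 1.

(* Multiplication by [r] is injective on R/I, for an ideal [I] *)
Definition nonzerodivisor_mod (R : comPzRingType) (I : set R) (r : R) : Prop :=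
  forall x : R, I (r * x) -> I x.

Definition weak_regular (R : comPzRingType) (k : nat) (s : 'I_k -> R) : Prop :=
  forall i : 'I_k,
    nonzerodivisor_mod
      (@submod_gen R R^o _ (fun j : 'I_k => (j < i)%N) s) (s i).

Definition permutable (R : comPzRingType) (k : nat) (s : 'I_k -> R) : Prop :=
  forall sigma : {perm 'I_k}, weak_regular (fun i => s (sigma i)).

Definition is_monomial (R : comPzRingType) (k : nat) (s : 'I_k -> R) (m : R) :
    Prop :=
  exists alpha : 'I_k -> nat, m = \prod_(i < k) s i ^+ alpha i.

Definition is_term (R : comPzRingType) (k : nat) (s : 'I_k -> R) (t : R) :
    Prop :=
  exists u m : R, [/\ is_unit u, is_monomial s m & t = u * m].

Definition std_vec (R : comPzRingType) (A : Type) (i : A) : A -> R^o :=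
  fun j => if `[< j = i >] then 1 else 0.

Definition is_monomial_type_term (R : comPzRingType) (k : nat) (s : 'I_k -> R)
    (A : Type) (f : A -> R^o) : Prop :=
  exists (i : A) (t : R), is_term s t /\ f = t *: std_vec R i.

(* Free modules, possibly of infinite rank: [b] is a basis indexed by [B] *)
Definition is_basis (R : pzRingType) (M : lmodType R) (B : choiceType)
    (b : B -> M) : Prop :=
  (forall x : M, exists (r : seq B) (c : B -> R),
     x = \sum_(i <- r) c i *: b i) /\
  (forall (r : seq B) (c : B -> R), uniq r ->
     \sum_(i <- r) c i *: b i = 0 -> forall i, i \in r -> c i = 0).

Definition is_free (R : pzRingType) (M : lmodType R) : Prop :=
  exists (B : choiceType) (b : B -> M), is_basis b.

(* A free resolution 0 -> G p -> ... -> G 0 -> U -> 0, extended by zero modules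
   in degrees above [p]. The augmentation G 0 -> U is given as a map to the
   ambient module [M] with range the submodule [U]. *)
Definition has_free_resolution (R : pzRingType) (M : lmodType R) (U : set M)
    (p : nat) : Prop :=
  exists (G : nat -> lmodType R)
         (d : forall i : nat, {linear G i.+1 -> G i})
         (eps : {linear G 0%N -> M}),
    [/\ forall i, is_free (G i),
        forall i, (p < i)%N -> forall x : G i, x = 0,
        range eps = U,
        [set x | eps x = 0] = range (d 0%N)
      & forall i, [set x | d i x = 0] = range (d i.+1)].

(* Main.v *)
Require Import Defs.
From HB Require Import structures.
From mathcomp Require Import all_boot all_order all_algebra perm ring.
From mathcomp Require Import boolp classical_sets functions.

Set Implicit Arguments.
Unset Strict Implicit.
Unset Printing Implicit Defensive.

Import GRing.Theory.
Local Open Scope classical_set_scope.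
Local Open Scope ring_scope.

(** The generators are monomials placed on single coordinates, so [U] is the
    direct sum, over the finitely many coordinates involved, of ideals of [R]
    generated by monomials in the sequence.  Resolutions of the summands combine
    into one of [U] ([fpd_direct_sum]), and it remains to resolve each ideal by
    induction on the number of variables.

    Single out a variable [y].  A monomial ideal is [K + y L], where [K] is
    generated by the generators free of [y], and [L], which contains [K], is
    obtained by lowering the exponent of [y] by one in all generators.  The
    sequence
      [0 -> K -> K (+) L -> K + y L -> 0],
    with first map sending [b] to [(- y b, b)] and second map sending [(u, b)]
    to [u + y b], is exact as soon as [y] is a nonzerodivisor modulo [K].  As [K]
    involves one variable fewer, it has a resolution shorter by one, so that the
    mapping cone of the sequence ([fpd_cone]) has the length already allowed for
    [L]; and the exponents of [y] in [L] are smaller, so this second induction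
    ends.  With no variable left the ideal is zero or [R].

    The arithmetic input is that a variable is a nonzerodivisor modulo any
    monomial ideal in other variables ([nonzerodivisor_monomial]); it is proved
    along the same decomposition, starting from the case of ideals generated by
    some of the variables, which is permutability.

    Resolutions are handled through successive kernels.  The one tool of
    homological algebra is the horseshoe lemma ([fpd_extension]): a bound on the
    lengths of resolutions of a submodule and of an image is a bound for the
    extension of the one by the other. *)

(** * Submodules and finite free resolutions *)

Section FreeResolutions.
Variable R : pzRingType.
Implicit Types M N : lmodType R.

Definition is_submodule M (U : set M) : Prop :=
  U 0 /\ forall (c : R) x y, U x -> U y -> U (c *: x + y).

Lemma submoduleD M (U : set M) x y : is_submodule U -> U x -> U y -> U (x + y).
Proof. by move=> [_ UD] Ux Uy; rewrite -[x]scale1r; apply: UD. Qed.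

Lemma submoduleZ M (U : set M) (c : R) x : is_submodule U -> U x -> U (c *: x).
Proof. by move=> [U0 UD] Ux; rewrite -[_ *: _]addr0; apply: UD. Qed.

Lemma submoduleN M (U : set M) x : is_submodule U -> U x -> U (- x).
Proof. by move=> sU Ux; rewrite -scaleN1r; apply: submoduleZ. Qed.

Lemma submoduleB M (U : set M) x y : is_submodule U -> U x -> U y -> U (x - y).
Proof. by move=> sU Ux Uy; apply: submoduleD => //; apply: submoduleN. Qed.

Lemma submodule_sum M (U : set M) (I : Type) (r : seq I) (P : pred I)
    (F : I -> M) :
  is_submodule U -> (forall i, P i -> U (F i)) -> U (\sum_(i <- r | P i) F i).
Proof.
by move=> sU UF; elim/big_ind: _ => // [|x y]; [case: sU | apply: submoduleD].
Qed.

Definition kernel M N (f : {linear M -> N}) : set M := [set x | f x = 0].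

Lemma submodule_kernel M N (f : {linear M -> N}) : is_submodule (kernel f).
Proof.
split; first exact: linear0.
by move=> c x y fx fy; rewrite /kernel /= linearP fx fy scaler0 addr0.
Qed.

Lemma submoduleI M (U V : set M) :
  is_submodule U -> is_submodule V -> is_submodule (U `&` V).
Proof.
by move=> [U0 UD] [V0 VD]; split=> // c x y [Ux Vx] [Uy Vy]; split; auto.
Qed.

Lemma submodule0 M : is_submodule [set (0 : M)].
Proof. by split=> // c x y -> ->; rewrite scaler0 addr0. Qed.

Section LinearCombination.
Variables (M : lmodType R) (n : nat) (a : 'I_n -> M).

Definition lincomb (x : 'rV[R]_n) : M := \sum_j x 0 j *: a j.

Fact lincomb_is_linear : linear lincomb.
Proof.
move=> c x y; rewrite scaler_sumr -big_split; apply: eq_bigr => j _ /=.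
by rewrite !mxE scalerDl scalerA.
Qed.

HB.instance Definition _ :=
  GRing.isLinear.Build R 'rV[R]_n M *:%R lincomb lincomb_is_linear.

Lemma submodule_lincomb (U : set M) :
  is_submodule U -> (forall j, U (a j)) -> forall x, U (lincomb x).
Proof. by move=> sU Ua x; apply: submodule_sum => // j _; apply: submoduleZ. Qed.

Lemma lincomb_delta j : lincomb (delta_mx 0 j) = a j.
Proof.
rewrite /lincomb (bigD1 j) //= mxE !eqxx scale1r big1 ?addr0 // => i ij.
by rewrite mxE (negPf ij) andbF scale0r.
Qed.

End LinearCombination.

Lemma range_lincomb M n (a : 'I_n -> M) :
  range (lincomb a) = submod_gen predT a.
Proof.
rewrite /submod_gen; apply/seteqP; split=> [_ [x _ <-]|_ [c ->]] /=.
  by exists (x 0).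
exists (\row_j c j) => //.
by apply: eq_bigr => j _; rewrite mxE.
Qed.

Lemma linear_lincomb M N (f : {linear M -> N}) n (a : 'I_n -> M) x :
  f (lincomb a x) = lincomb (f \o a) x.
Proof. by rewrite linear_sum; apply: eq_bigr => j _; rewrite linearZ. Qed.

Definition join_family M m n (a : 'I_m -> M) (b : 'I_n -> M) (j : 'I_(m + n)) :=
  match fintype.split j with inl i => a i | inr i => b i end.

Lemma lincomb_join M m n (a : 'I_m -> M) (b : 'I_n -> M) x :
  lincomb (join_family a b) x = lincomb a (lsubmx x) + lincomb b (rsubmx x).
Proof.
rewrite /lincomb big_split_ord /=; congr (_ + _); apply: eq_bigr => j _;
  rewrite mxE /join_family.
  by rewrite (unsplitK (inl j)).
by rewrite (unsplitK (inr j)).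
Qed.

(** [fpd p U]: [U] has a resolution of length less than [p] by free modules of
    finite rank.  Measuring lengths strictly lets [fpd 0] say that [U] is
    zero, which is the base case of every induction on [p]; describing a module
    by successive kernels inside row spaces avoids both chain complexes and
    quotient modules. *)
Fixpoint fpd (p : nat) : forall M, set M -> Prop :=
  match p with
  | 0 => fun M U => U = [set 0]
  | q.+1 => fun M U => exists n (a : 'I_n -> M),
      range (lincomb a) = U /\ fpd q (kernel (lincomb a))
  end.

Lemma fpd_submodule p M (U : set M) : fpd p U -> is_submodule U.
Proof.
case: p => [->|p [n [a [<- _]]]]; first exact: submodule0.
split; first by exists 0 => //; rewrite linear0.
by move=> c _ _ [x _ <-] [y _ <-]; exists (c *: x + y) => //; rewrite linearP.
Qed.

Lemma fpdW p M (U : set M) : fpd p U -> fpd p.+1 U.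
Proof.
elim: p M U => [|p IHp] M U; last first.
  by move=> [n [a [aU ka]]]; exists n, a; split=> //; apply: IHp.
move=> /= ->; exists 0%N, (fun=> 0); split; apply/seteqP; split=> x /=.
- by case=> y _ <-; rewrite [y]thinmx0 linear0.
- by move=> ->; exists 0; rewrite // linear0.
- by move=> _; rewrite [x]thinmx0.
- by move=> ->; apply: linear0.
Qed.

Lemma fpd0 p M : fpd p [set (0 : M)].
Proof. by elim: p => // p; apply: fpdW. Qed.

(** The horseshoe lemma for [0 -> U `&` kernel g -> U -> g @` U -> 0]:
    generators of the two ends, the right-hand ones lifted to [U], together generate [U],
    and the relations between them form again an extension of the relations of
    the two ends.  That extension is exhibited by the two block projections of
    the row space. *)
Lemma fpd_extension p M N (U : set M) (g : {linear M -> N}) :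
  is_submodule U -> fpd p (g @` U) -> fpd p (U `&` kernel g) -> fpd p U.
Proof.
elim: p M N U g => [|p IHp] M N U g sU.
  move=> /= gU kU; apply/seteqP; split=> [x Ux|_ ->] /=; last by case: sU.
  have : (g @` U) (g x) by exists x.
  by rewrite gU /= => gx0; have : (U `&` kernel g) x by []; rewrite kU.
move=> [m [b [bU kb]]] [n [a [aU ka]]].
have /choice[h hP] j : exists y, U y /\ g y = b j.
  have [y Uy <-] : (g @` U) (b j); last by exists y.
  by rewrite -bU; exists (delta_mx 0 j); rewrite // lincomb_delta.
have gh x : g (lincomb h x) = lincomb b x.
  rewrite linear_lincomb; apply: eq_bigr => j _.
  by rewrite /= (hP j).2.
have Uh x : U (lincomb h x).
  by apply: submodule_lincomb => // j; case: (hP j).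
have Ua y : U (lincomb a y) /\ g (lincomb a y) = 0.
  by have : range (lincomb a) (lincomb a y) by [exists y]; rewrite aU.
exists (m + n)%N, (join_family h a); split.
  apply/seteqP; split=> [_ [x _ <-]|x Ux].
    by rewrite lincomb_join; apply: submoduleD => //; case: (Ua (rsubmx x)).
  have [u _ gu] : range (lincomb b) (g x) by rewrite bU; exists x.
  have [v _ xv] : range (lincomb a) (x - lincomb h u).
    rewrite aU; split; first exact: submoduleB.
    by rewrite /kernel /= linearB gh gu subrr.
  exists (row_mx u v) => //.
  by rewrite lincomb_join row_mxKl row_mxKr xv addrC subrK.
have sK := submodule_kernel (lincomb (join_family h a)).
apply: (IHp _ _ _ (@lsubmx R 1 m n)) => //.
  suff -> : lsubmx @` kernel (lincomb (join_family h a)) = kernel (lincomb b).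
    by [].
  apply/seteqP; split=> [_ [x kx <-]|x kx]; rewrite /kernel /=.
    move: kx; rewrite /kernel /= lincomb_join => /(congr1 g).
    by rewrite linearD linear0 gh (Ua _).2 addr0.
  have [v _ xv] : range (lincomb a) (- lincomb h x).
    rewrite aU; split; first exact: submoduleN.
    by rewrite /kernel /= linearN gh kx oppr0.
  exists (row_mx x v); rewrite ?row_mxKl //.
  by rewrite /kernel /= lincomb_join row_mxKl row_mxKr xv subrr.
set K := _ `&` _.
have KE x : K x <-> lsubmx x = 0 /\ lincomb a (rsubmx x) = 0.
  rewrite /K /kernel /= lincomb_join; split=> [[+ x0]|[x0 xa]].
    by rewrite x0 linear0 add0r.
  by rewrite x0 linear0 add0r.
apply: (IHp _ _ K (@rsubmx R 1 m n)).
- by apply: submoduleI => //; apply: submodule_kernel.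
- suff -> : rsubmx @` K = kernel (lincomb a) by [].
  apply/seteqP; split=> [_ [x /KE[_ kx] <-] //|x kx].
  by exists (row_mx 0 x); rewrite ?row_mxKr //; apply/KE; rewrite row_mxKl row_mxKr.
- suff -> : K `&` kernel rsubmx = [set 0] by apply: fpd0.
  apply/seteqP; split=> [x [/KE[x0 _] x1]|_ ->] /=.
    by rewrite -[x]hsubmxK x0 (x1 : rsubmx x = 0) row_mx0.
  by split; [apply/KE; rewrite !linear0 | apply: linear0].
Qed.

Corollary fpd_inj p M N (U : set M) (g : {linear M -> N}) :
  is_submodule U -> (forall x, U x -> g x = 0 -> x = 0) ->
  fpd p (g @` U) -> fpd p U.
Proof.
move=> sU injg; move/fpd_extension; apply=> //.
suff -> : U `&` kernel g = [set 0] by apply: fpd0.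
apply/seteqP; split=> [x [Ux gx]|_ ->]; first exact: injg.
by split; [case: sU | apply: linear0].
Qed.

(** The mapping cone of [0 -> U `&` kernel g -> U -> g @` U -> 0]: generators of
    [U] also generate [g @` U], and the relations between them are an extension
    of [U `&` kernel g] by the relations of [U]. *)
Lemma fpd_cone p M N (U : set M) (g : {linear M -> N}) :
  fpd p.+1 U -> fpd p (U `&` kernel g) -> fpd p.+1 (g @` U).
Proof.
move=> [n [a [aU ka]]] kU; exists n, (g \o a); split.
  apply/seteqP; split=> [_ [x _ <-]|_ [x + <-]].
    by exists (lincomb a x); rewrite -?aU ?linear_lincomb.
  by rewrite -aU => -[y _ <-]; exists y; rewrite ?linear_lincomb.
apply: (@fpd_extension _ _ _ _ (lincomb a)); first exact: submodule_kernel.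
  suff -> : lincomb a @` kernel (lincomb (g \o a)) = U `&` kernel g by [].
  apply/seteqP; split=> [_ [x kx <-]|x [+ gx]].
    by split; [rewrite -aU; exists x | rewrite /kernel /= linear_lincomb].
  by rewrite -aU => -[y _ yx]; exists y; rewrite // /kernel /= -linear_lincomb yx.
suff -> : kernel (lincomb (g \o a)) `&` kernel (lincomb a) = kernel (lincomb a).
  by [].
apply/setIidPr => x kx; rewrite /kernel /= -linear_lincomb.
by rewrite (kx : lincomb a x = 0) linear0.
Qed.

Lemma fpd_pair p M N (U : set M) (V : set N) :
  fpd p U -> fpd p V -> fpd p (U `*` V).
Proof.
move=> fU fV; have [sU sV] := (fpd_submodule fU, fpd_submodule fV).
have sUV : is_submodule (U `*` V : set (M * N)%type).
  split; first by split; [case: sU | case: sV].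
  by move=> c x y [Ux Vx] [Uy Vy]; split; [apply: sU.2|apply: sV.2].
apply: (fpd_extension (g := fst)) => //.
  suff -> : fst @` (U `*` V) = U by [].
  apply/seteqP; split=> [_ [x [Ux _] <-] //|x Ux].
  by exists (x, 0) => //; split=> //; case: sV.
apply: (fpd_inj (g := snd)).
- by apply: submoduleI => //; apply: submodule_kernel.
- by move=> [x y] [_ /= x0] /= y0; rewrite (x0 : x = 0) y0.
- suff -> : snd @` ((U `*` V) `&` kernel fst) = V by [].
  apply/seteqP; split=> [_ [x [[_ Vx] _] <-] //|x Vx].
  by exists (0, x) => //; split=> //; split=> //; case: sU.
Qed.

Lemma is_free_rV n : is_free 'rV[R]_n.
Proof.
exists 'I_n, (fun j => delta_mx 0 j); split=> [x|r c].
  by exists (index_enum 'I_n), (x 0); rewrite [LHS]row_sum_delta.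
move=> ur sum0 i ir; have /(congr1 (fun x : 'rV_n => x 0 i)) := sum0.
rewrite summxE mxE (bigD1_seq i) //= !mxE !eqxx mulr1 big1 ?addr0 //.
by move=> j ji; rewrite !mxE (negPf (_ : i != j)) ?andbF ?mulr0 // eq_sym.
Qed.

Lemma fpd_resolution p M (U : set M) : fpd p.+1 U -> has_free_resolution U p.
Proof.
elim: p M U => [|p IHp] M U [n [a [aU ka]]].
  pose G i : lmodType R := if i is _.+1 then 'rV[R]_0 else 'rV[R]_n.
  pose d i : {linear G i.+1 -> G i} := lincomb (fun=> 0).
  have d0 i : range (d i) = [set 0].
    apply/seteqP; split=> [_ [x _ <-]|_ ->] /=; last by exists 0; rewrite ?linear0.
    by rewrite [x]thinmx0 linear0.
  exists G, d, (lincomb a); split=> //.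
  - by case=> [|i]; apply: is_free_rV.
  - by case=> // i _ x; apply: thinmx0.
  - by rewrite d0.
  - move=> i; rewrite d0; apply/seteqP; split=> x /= _; first exact: thinmx0.
    by rewrite [x]thinmx0 linear0.
have [G [d [eps [Gfree Gbound rng ex0 ex]]]] := IHp _ _ ka.
pose G' i : lmodType R := if i is j.+1 then G j else 'rV[R]_n.
pose d' i : {linear G' i.+1 -> G' i} :=
  match i with 0 => eps | j.+1 => d j end.
exists G', d', (lincomb a); split=> //.
- by case=> //; apply: is_free_rV.
- by case=> // i; apply: Gbound.
- by case.
Qed.

End FreeResolutions.

(** * Monomial ideals *)

Section GeneratedSubmodules.
Variables (R : pzRingType) (M : lmodType R).

Definition span (G : set M) : set M :=
  [set x | forall V : set M, is_submodule V -> G `<=` V -> V x].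

Lemma submodule_span G : is_submodule (span G).
Proof.
split=> [V sV _|c x y Gx Gy V sV GV]; first by case: sV.
by apply: sV.2; [apply: Gx | apply: Gy].
Qed.

Lemma span_gen G : G `<=` span G.
Proof. by move=> x Gx V _; apply. Qed.

Lemma span_sub G (V : set M) : is_submodule V -> G `<=` V -> span G `<=` V.
Proof. by move=> sV GV x; apply. Qed.

Lemma submodule_submod_gen (J : finType) (P : pred J) (a : J -> M) :
  is_submodule (submod_gen P a).
Proof.
split=> [|c _ _ [x ->] [y ->]].
  by exists (fun=> 0); rewrite big1 // => j _; rewrite scale0r.
exists (fun j => c * x j + y j); rewrite scaler_sumr -big_split.
by apply: eq_bigr => j _ /=; rewrite scalerDl scalerA.
Qed.

Lemma submod_gen_gen (J : finType) (P : pred J) (a : J -> M) j :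
  P j -> submod_gen P a (a j).
Proof.
move=> Pj; exists (fun i => (i == j)%:R).
rewrite (bigD1 j) //= eqxx scale1r big1 ?addr0 // => i /andP[_ ij].
by rewrite (negPf ij) scale0r.
Qed.

End GeneratedSubmodules.

Section MonomialIdeals.
Variables (R : comPzRingType) (I : eqType) (s : I -> R).
Implicit Types (S T : seq I) (K L : set R^o).

Fact regular_scalerAr (c r : R) (x : R^o) : r * (c *: x) = c *: (r * x : R^o).
Proof. exact: mulrCA. Qed.

Lemma ideal_mull K (r x : R) : is_submodule K -> K x -> K (r * x).
Proof. exact: submoduleZ. Qed.

Lemma ideal_mulr K (r x : R) : is_submodule K -> K x -> K (x * r).
Proof. by rewrite mulrC; apply: ideal_mull. Qed.

Definition ideal_addM K (r : R) L : set R^o :=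
  [set z | exists u b, [/\ K u, L b & z = u + r * b]].

Lemma submodule_ideal_addM K r L :
  is_submodule K -> is_submodule L -> is_submodule (ideal_addM K r L).
Proof.
move=> sK sL; split.
  by exists 0, 0; split; [case: sK | case: sL | rewrite mulr0 addr0].
move=> c _ _ [u [b [Ku Lb ->]]] [u' [b' [Ku' Lb' ->]]].
exists (c *: u + u'), (c *: b + b'); split; [exact: sK.2 | exact: sL.2|].
by rewrite scalerDr addrACA mulrDr regular_scalerAr.
Qed.

(** The ideals of [R] built along the decomposition [K + y L], [K `<=` L].
    The list orders the variables and each constructor singles out its head, so that an
    induction on the derivation is the double induction on the number of
    variables and on the exponents of the first one.
    [monomial_ideal_span] links this to ideals generated by monomials. *)
Inductive monomial_ideal : seq I -> set R^o -> Prop :=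
| Monomial0 : monomial_ideal [::] [set 0]
| Monomial1 : monomial_ideal [::] setT
| MonomialW y S K : monomial_ideal S K -> monomial_ideal (y :: S) K
| MonomialAdd y S K L : monomial_ideal S K -> monomial_ideal (y :: S) L ->
    K `<=` L -> monomial_ideal (y :: S) (ideal_addM K (s y) L).

Lemma submodule_monomial_ideal S K : monomial_ideal S K -> is_submodule K.
Proof.
elim=> // [|y {}S {}K L _ sK _ sL _]; first exact: submodule0.
exact: submodule_ideal_addM.
Qed.

Fixpoint var_ideal T : set R^o :=
  if T is y :: T' then ideal_addM (var_ideal T') (s y) setT else [set 0].

Lemma submodule_var_ideal T : is_submodule (var_ideal T).
Proof.
by elim: T => [|y T IHT]; [apply: submodule0 | apply: submodule_ideal_addM].
Qed.

Lemma var_ideal_sub T (V : set R^o) :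
  is_submodule V -> (forall i, i \in T -> V (s i)) -> var_ideal T `<=` V.
Proof.
move=> sV; elim: T => [|y T IHT] TV x /=; first by move=> ->; case: sV.
move=> [u [b [Tu _ ->]]]; apply: submoduleD => //.
  by apply: IHT => // i iT; apply: TV; rewrite inE iT orbT.
by apply: ideal_mulr => //; apply/TV/mem_head.
Qed.

Lemma var_ideal_mem T i : i \in T -> var_ideal T (s i).
Proof.
elim: T => // y T IHT; rewrite inE => /orP[/eqP ->|/IHT Ti] /=.
  by exists 0, 1; rewrite mulr1 add0r; split=> //; case: (submodule_var_ideal T).
by exists (s i), 0; rewrite mulr0 addr0.
Qed.

(** What a permutable weak regular sequence provides, freed from permutations:
    the initial segment and the term after it are any distinct members. *)
Definition regular_family :=
  forall T x, uniq (x :: T) -> nonzerodivisor_mod (var_ideal T) (s x).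

(** Adjoining variables [T] to the ideal is what makes the induction work.
    Modulo [K + y L + (T)], first read [s x * r] modulo [K + (y) + (T)], where
    only [K] is left as a monomial part; this gives [r = a + y b] up to [(T)].
    Cancelling [y] modulo [K + (T)] then moves the problem to [b] modulo
    [L + (T)].  The factor [1] turns [ideal_addM] into a sum of ideals. *)
Lemma nonzerodivisor_monomial_add S K :
  regular_family -> monomial_ideal S K -> forall T x, uniq (x :: S ++ T) ->
  nonzerodivisor_mod (ideal_addM K 1 (var_ideal T)) (s x).
Proof.
move=> s_reg; elim=> {S K} [T x|T x _ r _|y S K _ IH T x|].
- move=> uxT r [_ [t [-> Tt]]]; rewrite add0r mul1r => xr.
  by exists 0, r; split; rewrite ?add0r ?mul1r //; apply: s_reg uxT _ _; rewrite xr.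
- exists r, 0; rewrite mulr0 addr0; split=> //.
  by case: (submodule_var_ideal T).
- by rewrite /= inE negb_or -!andbA => /and4P[_ xS _ uS]; apply: IH; rewrite /= xS.
move=> y S K L mK IHK mL IHL KL T x uxyST r.
have [sK sL] := (submodule_monomial_ideal mK, submodule_monomial_ideal mL).
have sT := submodule_var_ideal T.
have uxSyT : uniq (x :: S ++ y :: T).
  rewrite -(perm_uniq (s1 := x :: y :: S ++ T)) // perm_cons.
  exact/permPl/(perm_catCA [:: y]).
have uyST : uniq (y :: S ++ T) by case/andP: uxyST.
move=> [_ [t [[u [j [Ku Lj ->]]] Tt]]]; rewrite mul1r => xr.
(* [y] joins [T], so the hypothesis on [K] applies to [s x] *)
have [|a [_ [Ka [t1 [b [Tt1 _ ->]]]]]] := IHK _ _ uxSyT r.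
  exists u, (t + s y * j); split=> //; first by exists t, j.
  by rewrite xr mul1r addrAC addrA.
rewrite mul1r => rE.
(* the hypothesis on [K] again, now for [y] itself *)
have [|a' [t2 [Ka' Tt2]]] := IHK _ _ uyST (s x * b - j).
  exists (u - s x * a), (t - s x * t1); split.
  - by apply: submoduleB => //; apply: submoduleZ.
  - by apply: submoduleB => //; apply: submoduleZ.
  - have yj : s y * j = s x * r - u - t by rewrite xr; ring.
    by rewrite mulrBr yj rE; ring.
rewrite mul1r => xbE.
have [|j' [t3 [Lj' Tt3]]] := IHL _ _ uxyST b.
  exists (j + a'), t2; split=> //; first by apply: submoduleD => //; apply: KL.
  by rewrite mul1r -addrA -xbE addrC subrK.
rewrite mul1r => bE.
exists (a + s y * j'), (t1 + s y * t3); split; first by exists a, j'.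
  by apply: submoduleD => //; apply: submoduleZ.
rewrite rE bE; ring.
Qed.

Lemma nonzerodivisor_monomial S K x :
  regular_family -> monomial_ideal S K -> uniq (x :: S) ->
  nonzerodivisor_mod K (s x).
Proof.
move=> s_reg mK uxS r Kxr.
have xK : nonzerodivisor_mod (ideal_addM K 1 (var_ideal [::])) (s x).
  by apply: (nonzerodivisor_monomial_add s_reg mK); rewrite cats0.
have [|u [_ [Ku -> ->]]] := xK r; last by rewrite mulr0 addr0.
by exists (s x * r), 0; split; rewrite ?mulr0 ?addr0.
Qed.

Definition addM_map (r : R) (z : (R^o * R^o)%type) : R^o := z.1 + r * z.2.

Fact addM_map_is_linear r : linear (addM_map r).
Proof. by move=> c x y; rewrite /addM_map /= scalerDr addrACA mulrDr regular_scalerAr. Qed.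

HB.instance Definition _ r :=
  GRing.isLinear.Build R (R^o * R^o)%type R^o *:%R (addM_map r)
    (addM_map_is_linear r).

Lemma fpd_setT : fpd 1 [set: R^o].
Proof.
have lincombE (x : 'rV[R]_1) : lincomb (fun=> 1 : R^o) x = x 0 0.
  by rewrite /lincomb big_ord1 [LHS]mulr1.
exists 1%N, (fun=> 1); split; apply/seteqP; split=> //.
- by move=> x _; exists (\row__ x) => //; rewrite lincombE mxE.
- move=> x; rewrite /kernel /= lincombE => x0.
  by apply/rowP => i; rewrite ord1 x0 mxE.
- by move=> _ ->; rewrite /kernel /= linear0.
Qed.

(** [size S] bounds the length: in the exact sequence from [K] to [K (+) L] to
    [K + y L], the kernel [K] has one variable fewer. *)
Lemma fpd_monomial_ideal S K :
  regular_family -> uniq S -> monomial_ideal S K -> fpd (size S).+1 K.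
Proof.
move=> s_reg + mK; elim: mK => {S K} [_|_|y S K _ IH /andP[_ uS]|].
- exact: fpd0.
- exact: fpd_setT.
- exact/fpdW/IH.
move=> y S K L mK IHK _ IHL KL uyS.
have /IHK fK : uniq S by case/andP: uyS.
have sK := submodule_monomial_ideal mK.
have fKL := fpd_pair (fpdW fK) (IHL uyS).
have -> : ideal_addM K (s y) L = addM_map (s y) @` (K `*` L).
  apply/seteqP; split=> [_ [u [b [Ku Lb ->]]]|_ [[u b] [Ku Lb] <-]].
    by exists (u, b).
  by exists u, b.
apply: fpd_cone => //; apply: (fpd_inj (g := snd)).
- apply: submoduleI; [exact: fpd_submodule fKL | exact: submodule_kernel].
- move=> [u b] [_ +] /= b0; rewrite /kernel /= /addM_map /= (b0 : b = 0).
  by rewrite mulr0 addr0 => ->.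
- suff -> : snd @` ((K `*` L) `&` kernel (addM_map (s y))) = K by [].
  apply/seteqP; split=> [_ [[u b] [[Ku Lb] +] <-]|b Kb].
    rewrite /kernel /= /addM_map /= => /eqP; rewrite addrC addr_eq0 => /eqP yb.
    have yK : nonzerodivisor_mod K (s y) by apply: nonzerodivisor_monomial uyS.
    apply: (yK b).
    by rewrite yb; apply: submoduleN.
  exists (- (s y * b), b) => //; split; last by rewrite /kernel /= /addM_map /= addNr.
  by split=> /=; [apply: (submoduleN sK); apply: ideal_mull | apply: KL].
Qed.

Definition monomial S (alpha : I -> nat) : R^o := \prod_(i <- S) s i ^+ alpha i.

(** Exponents equal to [0] stay [0]: a monomial free of [y] is then also a
    generator of the lowered ideal, whence [K `<=` L]. *)
Definition decr y (alpha : I -> nat) (i : I) : nat :=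
  if i == y then (alpha i).-1 else alpha i.

Lemma monomial_decr y S alpha :
  y \notin S -> monomial S (decr y alpha) = monomial S alpha.
Proof.
move=> yS; apply: eq_big_seq => i iS; rewrite /decr ifN //.
by apply: contra yS => /eqP <-.
Qed.

Lemma monomial_cons0 y S alpha :
  alpha y = 0%N -> monomial (y :: S) alpha = monomial S alpha.
Proof. by move=> y0; rewrite /monomial big_cons y0 mul1r. Qed.

Lemma monomial_cons_decr y S alpha : y \notin S -> (0 < alpha y)%N ->
  s y * monomial (y :: S) (decr y alpha) = monomial (y :: S) alpha.
Proof.
move=> yS y0; have := monomial_decr alpha yS; rewrite /monomial !big_cons => ->.
by rewrite mulrA -exprS /decr eqxx prednK.
Qed.

Definition bounded_at (E : set (I -> nat)) i :=
  exists d, forall alpha, E alpha -> (alpha i <= d)%N.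

(** The decomposition [K + y L] is applied repeatedly: [K] comes from the exponents
    with [alpha y = 0] and [L] from [decr y].  The bounds on the exponents make the
    repeated lowering of that of [y] terminate. *)
Lemma monomial_ideal_span S (E : set (I -> nat)) :
  uniq S -> (forall i, i \in S -> bounded_at E i) ->
  monomial_ideal S (span (monomial S @` E)).
Proof.
elim: S E => [|y S IHS] E.
  move=> _ _; have [[alpha Ea]|E0] := pselect (E !=set0).
    suff -> : span (monomial [::] @` E) = setT by constructor.
    apply/seteqP; split=> // r _; rewrite -[r]mulr1.
    apply: (ideal_mull _ (submodule_span _)).
    by apply: span_gen; exists alpha; rewrite // /monomial big_nil.
  suff -> : span (monomial [::] @` E) = [set 0] by constructor.
  apply/seteqP; split=> [|_ ->]; last first.
    by case: (submodule_span (monomial [::] @` E)).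
  apply: span_sub; first exact: submodule0.
  by move=> x [alpha Ea _]; case: E0; exists alpha.
move=> /andP[yS uS] bE.
have [d] := bE y (mem_head _ _).
have {bE} : forall i, i \in S -> bounded_at E i.
  by move=> i iS; apply: bE; rewrite inE iS orbT.
elim: d E => [|d IHd] E bE dE.
  suff -> : monomial (y :: S) @` E = monomial S @` E.
    by constructor; apply: IHS.
  apply: eq_imagel => alpha /dE; rewrite leqn0 => /eqP.
  exact: monomial_cons0.
pose E0 := [set alpha | E alpha /\ alpha y = 0%N].
have mK : monomial_ideal S (span (monomial S @` E0)).
  by apply: IHS => // i /bE[e be]; exists e => alpha [/be].
have mL : monomial_ideal (y :: S) (span (monomial (y :: S) @` (decr y @` E))).
  apply: IHd => [i /bE[e be]|_ [alpha Ea <-]].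
    exists e => _ [alpha /be ae <-]; apply: leq_trans ae.
    by rewrite /decr; case: ifP => // _; apply: leq_pred.
  by rewrite /decr eqxx -subn1 leq_subLR add1n; apply: dE.
have sK := submodule_monomial_ideal mK.
have sL := submodule_monomial_ideal mL.
have KL : span (monomial S @` E0) `<=` span (monomial (y :: S) @` (decr y @` E)).
  apply: span_sub => // _ [alpha [Ea a0] <-].
  apply: span_gen; exists (decr y alpha); first by exists alpha.
  by rewrite monomial_cons0 ?monomial_decr // /decr eqxx a0.
suff -> : span (monomial (y :: S) @` E) =
  ideal_addM (span (monomial S @` E0)) (s y)
    (span (monomial (y :: S) @` (decr y @` E))) by constructor.
have sE := submodule_span (monomial (y :: S) @` E).
apply/seteqP; split.
  apply: span_sub; first exact: submodule_ideal_addM.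
  move=> _ [alpha Ea <-]; have [a0|a0] := posnP (alpha y).
    exists (monomial (y :: S) alpha), 0; split; last by rewrite mulr0 addr0.
      by apply: span_gen; exists alpha; rewrite // monomial_cons0.
    by case: sL.
  exists 0, (monomial (y :: S) (decr y alpha)); split; first by case: sK.
    by apply: span_gen; exists (decr y alpha) => //; exists alpha.
  by rewrite add0r monomial_cons_decr.
move=> _ [u [b [Ku Lb ->]]]; apply: (submoduleD sE).
  apply: (span_sub _ _ Ku) => // _ [alpha [Ea a0] <-].
  by apply: span_gen; exists alpha; rewrite // monomial_cons0.
apply: (Lb [set b' | span (monomial (y :: S) @` E) (s y * b')]).
  split; first by rewrite /= mulr0; case: sE.
  by move=> c x z Ex Ez; rewrite /= mulrDr regular_scalerAr; apply: sE.2.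
move=> _ [_ [alpha Ea <-] <-] /=; have [a0|a0] := posnP (alpha y).
  apply: (ideal_mull _ sE); apply: span_gen; exists alpha => //.
  by rewrite !monomial_cons0 ?monomial_decr // /decr eqxx a0.
by rewrite monomial_cons_decr //; apply: span_gen; exists alpha.
Qed.

End MonomialIdeals.

(** * Permutable weak regular sequences *)

(** Some permutation of the indices lists [T] first and [x] right after it. *)
Lemma regular_family_permutable (R : comPzRingType) (k : nat) (s : 'I_k -> R) :
  permutable s -> regular_family s.
Proof.
move=> s_perm T x uxT r Txr.
pose l := T ++ x :: [seq i <- enum 'I_k | i \notin x :: T].
have l_perm : perm_eq l (enum 'I_k).
  apply: uniq_perm; rewrite ?enum_uniq //.
    rewrite /l -cat_rcons cat_uniq rcons_uniq; move: (uxT) => /= /andP[-> ->] /=.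
    rewrite filter_uniq ?enum_uniq // andbT; apply/hasPn => i.
    by rewrite mem_filter mem_rcons => /andP[].
  move=> i; rewrite mem_enum mem_cat inE mem_filter mem_enum inE andbT.
  by case: (i == x); case: (i \in T).
have size_l : size l = k by rewrite (perm_size l_perm) size_enum_ord.
have f_inj : injective (fun i : 'I_k => nth x l i).
  move=> i j /eqP; rewrite nth_uniq ?size_l ?(perm_uniq l_perm) ?enum_uniq //.
  by move/eqP/val_inj.
have T_lt : (size T < k)%N by rewrite -[X in (_ < X)%N]size_l size_cat /= -addSnnS leq_addr.
have nth_T (j : 'I_k) : (j < size T)%N -> perm f_inj j \in T.
  by move=> jT; rewrite permE nth_cat jT mem_nth.
pose V := @submod_gen R R^o _ (fun j : 'I_k => (j < Ordinal T_lt)%N)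
            (fun i => s (perm f_inj i)).
suff /(_ r) Vr : nonzerodivisor_mod V (s x).
  have [|c ->] := Vr.
    apply: var_ideal_sub Txr; first exact: submodule_submod_gen.
    move=> i iT; have j_lt : (index i T < k)%N.
      by apply: (ltn_trans _ T_lt); rewrite index_mem.
    have -> : i = perm f_inj (Ordinal j_lt).
      by rewrite permE /= nth_cat index_mem iT nth_index.
    by apply: (@submod_gen_gen _ R^o); rewrite /= index_mem.
  apply: submodule_sum; first exact: submodule_var_ideal.
  move=> j jT; apply: submoduleZ; first exact: submodule_var_ideal.
  by apply: var_ideal_mem; apply: nth_T.
suff -> : x = perm f_inj (Ordinal T_lt) by apply: s_perm.
by rewrite permE /= nth_cat ltnn subnn.
Qed.

(** * Submodules of a product *)

Section Product.
Variables (R : comPzRingType) (A : Type).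

Definition coordinate (i : A) (f : A -> R^o) : R^o := f i.

Fact coordinate_is_linear i : linear (coordinate i).
Proof. by []. Qed.

HB.instance Definition _ i :=
  GRing.isLinear.Build R (A -> R^o)%type R^o *:%R (coordinate i)
    (coordinate_is_linear i).

Definition direct_sum (K : A -> set R^o) (B : seq {classic A}) : set (A -> R^o) :=
  [set f | forall i : {classic A}, K i (f i) /\ (i \notin B -> f i = 0)].

Lemma std_vecE (c : R) (i j : {classic A}) :
  (c *: std_vec R i : A -> R^o) j = if j == i then c else 0.
Proof.
rewrite scalrfctE /std_vec; case: eqP => ij; last by rewrite asboolF // scaler0.
by rewrite asboolT // [LHS]mulr1.
Qed.

Lemma submodule_direct_sum K B :
  (forall i, is_submodule (K i)) -> is_submodule (direct_sum K B).
Proof.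
move=> sK; split=> [i|c f g Kf Kg i]; first by split=> //; case: (sK i).
split; first by apply: (sK i).2; [case: (Kf i) | case: (Kg i)].
move=> iB; rewrite -[LHS]/(c *: f i + g i) (Kf i).2 // (Kg i).2 //.
by rewrite scaler0 addr0.
Qed.

(** Coordinates are split off one at a time, each by an extension. *)
Lemma fpd_direct_sum p (K : A -> set R^o) B :
  (forall i, fpd p (K i)) -> fpd p (direct_sum K B).
Proof.
move=> fK; have sK i := fpd_submodule (fK i).
elim: B => [|i B IHB].
  suff -> : direct_sum K [::] = [set 0] by apply: fpd0.
  apply/seteqP; split=> [f Kf|_ ->].
    by apply/funext => i; apply: (Kf i).2.
  by case: (submodule_direct_sum [::] sK).
have [iB|iB] := boolP (i \in B).
  suff -> : direct_sum K (i :: B) = direct_sum K B by [].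
  apply/seteqP; split=> f Kf j; have [Kj jB] := Kf j; split=> // jNB; apply: jB.
    by rewrite inE negb_or jNB andbT; apply: contra jNB => /eqP ->.
  by move: jNB; rewrite inE negb_or => /andP[].
apply: (fpd_extension (g := coordinate i)).
- exact: submodule_direct_sum.
- suff -> : coordinate i @` direct_sum K (i :: B) = K i by [].
  apply/seteqP; split=> [_ [f Kf <-]|r Kr]; first by case: (Kf i).
  exists (r *: std_vec R i); last by rewrite /coordinate std_vecE eqxx.
  move=> j; rewrite std_vecE inE negb_or; case: eqP => [->|_] //; split=> //.
  by case: (sK j).
- suff -> : direct_sum K (i :: B) `&` kernel (coordinate i) = direct_sum K B by [].
  apply/seteqP; split=> [f [Kf fi] j|f Kf].
    have [Kj jB] := Kf j; split=> // jNB.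
    have [->//|ji] := eqVneq j i; apply: jB.
    by rewrite inE negb_or ji.
  split; last exact: (Kf i).2.
  move=> j; have [Kj jB] := Kf j; split=> //.
  by rewrite inE negb_or => /andP[_ /jB].
Qed.

Lemma direct_sum_sub (K : A -> set R^o) B (U : set (A -> R^o)) :
  (forall i, is_submodule (K i)) -> is_submodule U ->
  (forall i r, K i r -> U (r *: std_vec R i)) -> direct_sum K B `<=` U.
Proof.
move=> sK sU KU; elim: B => [|i B IHB] f Kf.
  suff -> : f = 0 by case: sU.
  by apply/funext => i; apply: (Kf i).2.
rewrite -(subrK (f i *: std_vec R i) f); apply: submoduleD => //; last first.
  by apply: KU; case: (Kf i).
apply: IHB => j; have [Kj jB] := Kf j.
have -> : (f - f i *: std_vec R i) j = if j == i then 0 else f j.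
  rewrite -[LHS]/(f j - (f i *: std_vec R i : A -> R^o) j) std_vecE.
  by case: eqP => [->|_]; rewrite ?subrr ?subr0.
case: eqP => [_|/eqP ji]; first by split=> //; case: (sK j).
by split=> // jNB; apply: jB; rewrite inE negb_or ji.
Qed.

End Product.

Theorem theorem3p10 (R : comPzRingType) (A : Type) (k : nat) (s : 'I_k -> R)
    (s_regular : weak_regular s) (s_permutable : permutable s)
    (s_nonunit : forall i : 'I_k, ~ is_unit (s i))
    (n : nat) (a : 'I_n -> (A -> R^o)%type)
    (a_term : forall j : 'I_n, is_monomial_type_term s (a j)) :
  exists p : nat, (p <= k)%N /\ has_free_resolution (submod_gen predT a) p.
Proof.
exists k; split=> //; apply: fpd_resolution.
have /choice[w wP] j : exists w : A * R * ('I_k -> nat),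
    is_unit w.1.2 /\
    a j = (w.1.2 * monomial s (enum 'I_k) w.2) *: std_vec R w.1.1.
  have [i [t [[u [m [uu [al mE] tE]]] ->]]] := a_term j.
  by exists (i, u, al); split=> //=; rewrite tE mE /monomial big_enum.
pose E i := [set al | exists j, (w j).1.1 = i /\ al = (w j).2].
pose K i := span (monomial s (enum 'I_k) @` E i).
have sK i : is_submodule (K i) by apply: submodule_span.
have fK i : fpd k.+1 (K i).
  rewrite -{1}(size_enum_ord k); apply: (fpd_monomial_ideal (s := s)).
  - exact: regular_family_permutable.
  - exact: enum_uniq.
  apply: monomial_ideal_span; first exact: enum_uniq.
  move=> l _; exists (\max_j (w j).2 l) => _ [j [_ ->]].
  exact: (leq_bigmax (F := fun j => (w j).2 l)).
suff -> : submod_gen predT a = direct_sum K [seq (w j).1.1 | j : 'I_n].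
  exact: fpd_direct_sum.
have sU := submodule_submod_gen predT a.
apply/seteqP; split.
  have sB := submodule_direct_sum [seq (w j).1.1 | j : 'I_n] sK.
  move=> _ [c ->]; apply: (submodule_sum _ sB) => j _.
  suff Bj : direct_sum K [seq (w j).1.1 | j : 'I_n] (a j).
    exact: submoduleZ sB Bj.
  rewrite (wP j).2 => i; rewrite std_vecE; case: eqP => [->|ij].
    split; last first.
      by move/negP; case; apply: (codom_f (fun j => (w j).1.1 : {classic A})).
    apply: (ideal_mull _ (sK _)); apply: span_gen.
    by exists (w j).2 => //; exists j.
  by split=> //; case: (sK i).
apply: direct_sum_sub => // i r.
move=> Kr; apply: (Kr [set r' | submod_gen predT a (r' *: std_vec R i)]).
  split; first by rewrite /= scale0r; case: sU.
  move=> c x y Ux Uy; rewrite /= scalerDl -scalerA.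
  exact: sU.2.
move=> _ [_ [j [<- ->]] <-] /=.
(* the unit in the term [a j] is cancelled by scaling with its inverse [v] *)
have [[v uv] aj] := wP j.
have Uj : submod_gen predT a (a j) by apply: submod_gen_gen.
have := submoduleZ v sU Uj.
by rewrite aj scalerA mulrA [v * _]mulrC uv mul1r.
Qed.
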